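(* There exist convex $4$-dimensional polytopes $P$ with fatness $\phi(P) > 5.048$.
   Context: For a convex $4$-polytope $P$, let $f_k(P)$ denote the number of $k$-dimensional faces of $P$, for $k=0,1,2,3$. The fatness of $P$ is $$\phi(P)=\frac{f_1(P)+f_2(P)}{f_0(P)+f_3(P)}.$$ *)

(* Defs.v *)
From HB Require Import structures.
From mathcomp Require Import all_boot all_order all_algebra finmap.
From mathcomp Require Import boolp classical_sets functions cardinality reals.

Set Implicit Arguments.
Unset Strict Implicit.
Unset Printing Implicit Defensive.

Import Order.TTheory GRing.Theory Num.Theory.

Local Open Scope classical_set_scope.
Local Open Scope ring_scope.

Definition dot (R : realType) (n : nat) (c x : 'rV[R]_n) : R :=
  \sum_(i < n) c 0 i * x 0 i.

(* Repeated points in [s] are harmless: the weight [w v] is then counted once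
   per occurrence of [v] in both sums. *)
Definition convex_hull (R : realType) (n : nat) (s : seq 'rV[R]_n) :
    set 'rV[R]_n :=
  [set x | exists w : 'rV[R]_n -> R,
     [/\ forall v, v \in s -> 0 <= w v,
         \sum_(v <- s) w v = 1
       & x = \sum_(v <- s) w v *: v] ].

Definition affine_hull (R : realType) (n : nat) (A : set 'rV[R]_n) :
    set 'rV[R]_n :=
  [set x | exists (s : seq 'rV[R]_n) (w : 'rV[R]_n -> R),
     [/\ forall v, v \in s -> A v,
         \sum_(v <- s) w v = 1
       & x = \sum_(v <- s) w v *: v] ].

(* The dimension of a set is that of its affine hull, a translate of a linear
   subspace; no natural number is a dimension of the empty set. *)
Definition has_dim (R : realType) (n : nat) (A : set 'rV[R]_n) (k : nat) :
    Prop :=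
  exists (p : 'rV[R]_n) (U : {vspace 'rV[R]_n}),
    affine_hull A = [set p + u | u in [set` U]] /\ \dim U = k.

Definition is_polytope (R : realType) (n : nat) (P : set 'rV[R]_n) : Prop :=
  exists s : seq 'rV[R]_n, P = convex_hull s.

(* The linear form [c] may be zero, so [P] itself and the empty set are
   (improper) faces. *)
Definition is_face (R : realType) (n : nat) (P F : set 'rV[R]_n) : Prop :=
  exists (c : 'rV[R]_n) (a : R),
    (forall x, P x -> dot c x <= a) /\ F = P `&` [set x | dot c x = a].

Definition faces (R : realType) (n : nat) (P : set 'rV[R]_n) (k : nat) :
    set (set 'rV[R]_n) :=
  [set F | is_face P F /\ has_dim F k].

(* [fset_set] sends infinite sets to the empty one, which never happens for a
   polytope: it has finitely many faces. *)
Definition face_number (R : realType) (n : nat) (P : set 'rV[R]_n) (k : nat) :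
    nat :=
  #|` fset_set (faces P k)|.

Definition fatness (R : realType) (n : nat) (P : set 'rV[R]_n) : rat :=
  (face_number P 1 + face_number P 2)%:R /
  (face_number P 0 + face_number P 3)%:R.

(* Main.v *)
From Stdlib Require Import ZArith.
Require Import Defs.
From mathcomp Require Import all_boot all_order all_algebra finmap.
From mathcomp Require Import boolp classical_sets cardinality reals.
From mathcomp Require Import lra ring zify ssrZ.

Set Implicit Arguments.
Unset Strict Implicit.
Unset Printing Implicit Defensive.

Import Order.TTheory GRing.Theory Num.Theory.

Local Open Scope classical_set_scope.
Local Open Scope ring_scope.

(** The polytope is the E-construction applied to a product of two polygons.
    Take a simple 4-polytope and put a new vertex beyond each of its facets so
    that, for each ridge, the two new vertices next to it span a common
    hyperplane with it. The convex hull then has one facet for each ridge, a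
    bipyramid over that ridge, and hence one triangle for each incident pair
    (edge, facet), one edge for each old edge and one for each incident pair
    (vertex, facet). For the product of an m-gon and an n-gon, which has mn
    vertices, 2mn edges, mn + m + n ridges and m + n facets, this gives
    f0 = f3 = mn + m + n and f1 = f2 = 6mn. The fatness is
    6mn / (mn + m + n), which tends to 6; for m = n = 11 it is 66/13 = 5.07...

    The condition on ridges is planar. Let the polygon with vertices v_k be
    inscribed in another one with vertices a_k, each v_k lying on the side from
    a_(k-1) to a_k, and call n_k the linear form that is 1 on the edge from
    v_k to v_(k+1). If n_k(a_k) = 2 for every k, in both factors, then the
    hull of the points (v_i, w_k), (a_i, 0), (0, b_k) is cut out by
    n_i(x) + n'_k(y) <= 2 together with the inequalities of the sides of the
    two outer polygons. Such a pair of polygons is called a tent below.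

    That these inequalities suffice ([tent_product_cut_out]) is seen as
    follows. A point x of the outer polygon lies in the cone over some inner
    edge, where t = n_k(x) is maximal. If t <= 1 it is in the inner polygon;
    otherwise it splits as a point of (2 - t) times the inner polygon plus
    (t - 1) times a_k ([tent_decomposition]). If n_i(x) + n'_k(y) <= 2, the
    leftovers of the two factors have room for a common total weight, and are
    combined through the products (v_i, w_k).

    For the face numbers, a facet of a polytope cut out by finitely many
    inequalities is given by one of them ([face_number_facet_le]), which bounds
    f3, and a 0-dimensional face is a vertex, which bounds f0. Conversely the
    6mn edges and the 6mn triangles are exhibited as intersections of facets
    and distinguished by their vertices. A tent with 11 corners in the
    integral lattice finishes the proof. *)

(** * Linear forms and affine hulls *)

Section Dot.
Variables (R : realType) (n : nat).
Implicit Types (c x y : 'rV[R]_n) (k : R).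

Lemma dotDr c x y : dot c (x + y) = dot c x + dot c y.
Proof.
by rewrite /dot -big_split; apply: eq_bigr => i _; rewrite !mxE mulrDr.
Qed.

Lemma dotZr c k x : dot c (k *: x) = k * dot c x.
Proof.
by rewrite /dot mulr_sumr; apply: eq_bigr => i _; rewrite !mxE mulrCA.
Qed.

Lemma dotC c x : dot c x = dot x c.
Proof. by apply: eq_bigr => i _; rewrite mulrC. Qed.

Lemma dot0r c : dot c 0 = 0.
Proof. by rewrite /dot big1 // => i _; rewrite mxE mulr0. Qed.

Lemma dot0l x : dot 0 x = 0.
Proof. by rewrite dotC dot0r. Qed.

Lemma dotBr c x y : dot c (x - y) = dot c x - dot c y.
Proof. by rewrite dotDr -scaleN1r dotZr mulN1r. Qed.

Lemma dot_sumr c (I : Type) (r : seq I) (P : pred I) (F : I -> 'rV[R]_n) :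
  dot c (\sum_(i <- r | P i) F i) = \sum_(i <- r | P i) dot c (F i).
Proof. exact: (big_morph (dot c) (dotDr c) (dot0r c)). Qed.

Lemma dot_combr c (I : Type) (r : seq I) (P : pred I) (w : I -> R)
    (F : I -> 'rV[R]_n) :
  dot c (\sum_(i <- r | P i) w i *: F i) =
  \sum_(i <- r | P i) w i * dot c (F i).
Proof. by rewrite dot_sumr; apply: eq_bigr => i _; rewrite dotZr. Qed.

Lemma dot_gt0 c : c != 0 -> 0 < dot c c.
Proof.
move=> c0; rewrite lt_def sumr_ge0 ?andbT; last first.
  by move=> i _; rewrite -expr2 sqr_ge0.
apply: contra c0 => /eqP /psumr_eq0P cc; apply/eqP/rowP => i; rewrite mxE.
by apply/eqP; rewrite -sqrf_eq0 expr2 cc // => j _; rewrite -expr2 sqr_ge0.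
Qed.

End Dot.

Lemma dot_row (R : realType) m n (c x : 'rV[R]_m) (d y : 'rV[R]_n) :
  dot (row_mx c d) (row_mx x y) = dot c x + dot d y.
Proof.
rewrite /dot big_split_ord; congr (_ + _).
  by apply: eq_bigr => i _; rewrite !row_mxEl.
by apply: eq_bigr => i _; rewrite !row_mxEr.
Qed.

Section AffineHull.
Variables (R : realType) (n : nat).
Implicit Types (A : set 'rV[R]_n).

Lemma sub_affine_hull A : A `<=` affine_hull A.
Proof.
move=> x Ax; exists [:: x], (fun=> 1); split.
- by move=> v; rewrite inE => /eqP->.
- by rewrite big_seq1.
- by rewrite big_seq1 scale1r.
Qed.

Lemma dot_affine_hull A c a :
  (forall x, A x -> dot c x = a) -> forall x, affine_hull A x -> dot c x = a.
Proof.
move=> Aa x [s [w [sA w1 ->]]]; rewrite dot_combr.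
under eq_big_seq => v /sA /Aa -> do [].
by rewrite -mulr_suml w1 mul1r.
Qed.

Lemma has_dim_neq0 A k : has_dim A k -> exists x, A x.
Proof.
move=> [p [U [AU _]]].
have : affine_hull A (p + 0) by rewrite AU; exists 0 => //=; exact: mem0v.
move=> [[|x s] [w [sA w1 _]]]; last by exists x; apply: sA; rewrite mem_head.
by move: w1 => /esym/eqP; rewrite big_nil oner_eq0.
Qed.

Lemma has_dim0_set1 A x : has_dim A 0 -> A x -> A = [set x].
Proof.
move=> [p [U [AU /eqP]]]; rewrite dimv_eq0 => /eqP U0 Ax.
have Ap y : A y -> y = p.
  move=> /sub_affine_hull; rewrite AU U0 => -[u /=]; rewrite memv0 => /eqP -> <-.
  by rewrite addr0.
by apply/seteqP; split=> [y /Ap->|y /= ->//]; rewrite (Ap _ Ax).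
Qed.

End AffineHull.

(** * Cardinality of a set of faces *)

Section FsetCard.
Variables (T : finType) (U : choiceType) (f : T -> U) (A : set U).

Lemma range_fset : range f = [set` [fset f t | t : T]%fset].
Proof.
apply/seteqP; split=> [_ [t _ <-]|x /imfsetP[t _ ->]]; last by exists t.
by apply/imfsetP; exists t.
Qed.

Lemma card_fset_set_le : A `<=` range f -> (#|` fset_set A| <= #|T|)%N.
Proof.
move=> Af.
have finA : finite_set A by apply: sub_finite_set Af _; rewrite range_fset.
have := leq_imfset_card imfset_key f (mem T); rewrite /= -cardE; apply: leq_trans.
apply: fsubset_leq_card.
by rewrite -[X in (_ `<=` X)%fset]set_fsetK -fset_set_sub // -range_fset.
Qed.

Lemma card_fset_set_ge :
  injective f -> finite_set A -> range f `<=` A -> (#|T| <= #|` fset_set A|)%N.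
Proof.
move=> inj_f finA fA.
have := card_imfset imfset_key (mem T) inj_f; rewrite /= -cardE => <-.
apply: fsubset_leq_card.
by rewrite -[X in (X `<=` _)%fset]set_fsetK -fset_set_sub // -range_fset.
Qed.

End FsetCard.

(** * Polytopes with a prescribed incidence relation *)

(** A finite set of points and a finite set of inequalities valid on it.
    [incidentP] says at once that each inequality holds at each point and at
    which points it is an equality. [incident_inj] keeps the points apart
    without reference to coordinates: two points in the same position would
    lie on the same facets. *)
Record configuration (R : realType) (n : nat) := Configuration {
  vertex : finType;
  facet : finType;
  position : vertex -> 'rV[R]_n;
  normal : facet -> 'rV[R]_n;
  level : facet -> R;
  incident : facet -> vertex -> bool;
  level_gt0 : forall h, 0 < level h;
  incidentP : forall h j,
    dot (normal h) (position j) <= level h ?= iff incident h j;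
  incident_inj : forall i j, (forall h, incident h i = incident h j) -> i = j
}.

Section Configuration.
Variables (R : realType) (n : nat) (C : configuration R n).
Local Notation J := (vertex C).
Local Notation H := (facet C).
Local Notation pt := (@position R n C).
Local Notation inc := (@incident R n C).
Implicit Types (A : {set J}) (B : seq H) (h : H) (i j : J) (w : J -> R).

Lemma point_inj : injective pt.
Proof.
move=> i j ij; apply: incident_inj => h.
by have [_ <-] := incidentP h i; have [_ <-] := incidentP h j; rewrite ij.
Qed.

(** Convex and affine hulls weigh points, while [hull] below weighs indices; as
    positions are distinct, either kind of weight gives the other. *)
Lemma point_weight w : exists u : 'rV[R]_n -> R, forall j, u (pt j) = w j.
Proof.
exists (fun v => \sum_(j | pt j == v) w j) => j.
rewrite (big_pred1 j) // => i; exact: (inj_eq point_inj).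
Qed.

Definition hull A : set 'rV[R]_n :=
  [set x | exists w : J -> R,
    [/\ forall j, 0 <= w j, forall j, j \notin A -> w j = 0,
        \sum_j w j = 1 & x = \sum_j w j *: pt j]].

Definition body : set 'rV[R]_n := convex_hull (codom pt).

Lemma bodyE : body = hull finset.setT.
Proof.
apply/seteqP; split=> x.
  move=> [w [w0 w1 ->]]; exists (w \o pt); split=> [j|j||].
  - exact: w0 (codom_f _ _).
  - by rewrite inE.
  - by rewrite -w1 big_image.
  - by rewrite big_image.
move=> [w [w0 _ w1 ->]]; have [u uE] := point_weight w; exists u; split.
- by move=> _ /codomP[j ->]; rewrite uE.
- by rewrite -w1 big_image; apply: eq_bigr => j _; rewrite uE.
- by rewrite big_image; apply: eq_bigr => j _; rewrite uE.
Qed.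

Lemma point_hull A j : j \in A -> hull A (pt j).
Proof.
move=> jA; exists (fun i => (i == j)%:R); split=> [i|i||].
- exact: ler0n.
- by move=> iA; case: eqP => // ij; rewrite -ij (negPf iA) in jA.
- by rewrite (bigD1 j) //= eqxx big1 ?addr0 // => i /negPf->.
- rewrite (bigD1 j) //= eqxx scale1r big1 ?addr0 // => i /negPf->.
  by rewrite scale0r.
Qed.

Lemma hull_body A : hull A `<=` body.
Proof.
by rewrite bodyE => x [w [w0 wA w1 ->]]; exists w; split=> // j; rewrite inE.
Qed.

Lemma point_body j : body (pt j).
Proof. exact: hull_body (point_hull (set11 j)). Qed.

Lemma hull_neq0 A x : hull A x -> exists j, j \in A.
Proof.
move=> [w [_ wA w1 _]]; apply/set0Pn; apply: contra_eq_neq w1 => A0.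
by rewrite big1 1?eq_sym ?oner_eq0 // => j _; rewrite wA // A0 inE.
Qed.

(** In a convex combination that attains the bound, a vertex with positive slack
    has weight zero, as the weighted sum of the slacks vanishes. *)
Lemma face_hull c a :
  (forall x, body x -> dot c x <= a) ->
  body `&` [set x | dot c x = a] = hull [set j | dot c (pt j) == a].
Proof.
move=> ca; apply/seteqP; split=> x; last first.
  move=> xA; split; first exact: hull_body xA.
  case: xA => w [w0 wA w1 ->] /=.
  rewrite dot_combr -[RHS]mul1r -w1 mulr_suml; apply: eq_bigr => j _.
  case: (boolP (dot c (pt j) == a)) => [/eqP->//|ja].
  by rewrite wA ?inE // !mul0r.
rewrite bodyE => -[[w [w0 _ w1 ->]] /= wa]; exists w; split=> // j.
rewrite inE => ja.
have : \sum_j w j * (a - dot c (pt j)) = 0.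
  under eq_bigr do rewrite mulrBr.
  by rewrite sumrB -mulr_suml w1 mul1r -wa dot_combr subrr.
move/psumr_eq0P; have slack i : true -> 0 <= w i * (a - dot c (pt i)).
  by move=> _; rewrite mulr_ge0 // subr_ge0; apply: ca; exact: point_body.
move=> /(_ slack j isT) /eqP.
by rewrite mulf_eq0 subr_eq0 [a == _]eq_sym (negPf ja) orbF => /eqP.
Qed.

Lemma face_exists F : is_face body F -> exists A, F = hull A.
Proof. by move=> [c [a [ca ->]]]; rewrite face_hull //; eexists. Qed.

Lemma finite_faces k : finite_set (faces body k).
Proof.
apply: (@sub_finite_set _ _ (range hull)); last exact: finite_image.
by move=> F [/face_exists[A ->] _]; exists A.
Qed.

(** The vertices common to all facets in [B]. The sum of the inequalities in
    [B] is an equality exactly there, which makes their hull a face. *)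
Definition meet B : {set J} := [set j | all (inc^~ j) B].

Lemma meetP B j :
  dot (\sum_(h <- B) normal h) (pt j) <= \sum_(h <- B) level h
    ?= iff (j \in meet B).
Proof.
rewrite dotC dot_sumr inE; elim: B => [|h B IH].
  by rewrite !big_nil; split; rewrite ?eqxx.
rewrite !big_cons /=; apply: leifD => //; rewrite dotC; exact: incidentP.
Qed.

Lemma body_le c a :
  (forall j, dot c (pt j) <= a) -> forall x, body x -> dot c x <= a.
Proof.
rewrite bodyE => ca _ [w [w0 _ w1 ->]].
rewrite dot_combr -[a]mul1r -w1 mulr_suml.
by apply: ler_sum => j _; apply: ler_wpM2l.
Qed.

Lemma meet_hull B :
  body `&` [set x | dot (\sum_(h <- B) normal h) x = \sum_(h <- B) level h] =
  hull (meet B).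
Proof.
rewrite face_hull; last by apply: body_le => j; have [] := meetP B j.
by congr hull; apply/setP => j; rewrite inE; have [_ ->] := meetP B j.
Qed.

Lemma meet_face B : is_face body (hull (meet B)).
Proof.
exists (\sum_(h <- B) normal h), (\sum_(h <- B) level h).
split; last by rewrite meet_hull.
by apply: body_le => j; have [] := meetP B j.
Qed.

Lemma point_meet B j : hull (meet B) (pt j) <-> j \in meet B.
Proof.
split; last exact: point_hull.
by rewrite -meet_hull => -[_ /= /eqP]; have [_ ->] := meetP B j.
Qed.

(** The hull of an intersection of facets contains no further vertices, so
    distinct vertex sets of this kind span distinct faces. *)
Lemma card_face_ge (E : finType) (phi : E -> {set J}) k :
  injective phi ->
  (forall e, exists B, phi e = meet B) ->
  (forall e, has_dim (hull (phi e)) k) ->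
  (#|E| <= face_number body k)%N.
Proof.
move=> inj_phi phiB phik.
have key e j : hull (phi e) (pt j) <-> j \in phi e.
  by have [B ->] := phiB e; exact: point_meet.
apply: (@card_fset_set_ge _ _ (hull \o phi)).
- move=> e e' /= ee'; apply: inj_phi; apply/setP => j.
  by apply/idP/idP => /key; [rewrite ee'|rewrite -ee'] => /key.
- exact: finite_faces.
- move=> _ [e _ <-]; split => /=; last exact: phik.
  by have [B ->] := phiB e; exact: meet_face.
Qed.

Lemma affine_hull_point A w :
  (forall j, j \notin A -> w j = 0) -> \sum_j w j = 1 ->
  affine_hull (hull A) (\sum_j w j *: pt j).
Proof.
move=> wA w1; have [u uE] := point_weight w.
have sumA (V : nmodType) (F : J -> V) :
    (forall j, j \notin A -> F j = 0) -> \sum_(j in A) F j = \sum_j F j.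
  by move=> FA; rewrite [RHS](bigID (mem A)) /= [X in _ = _ + X]big1 ?addr0.
exists [seq pt j | j in A], u; split.
- by move=> _ /fintype.imageP[j jA ->]; exact: point_hull.
- by rewrite big_image /=; under eq_bigr do rewrite uE; rewrite sumA.
- rewrite big_image /=; under [RHS]eq_bigr do rewrite uE.
  by rewrite sumA // => j /wA ->; rewrite scale0r.
Qed.

(** The affine hull is [pt i] plus the span of the directions [pt j - pt i]: such
    a direction is a combination of vertices of total weight 0, and so is any
    combination of them. *)
Lemma has_dim_simplex i (s : seq J) :
  free [seq pt j - pt i | j <- s] ->
  has_dim (hull [set j in i :: s]) (size s).
Proof.
set X := [seq _ | _ <- _] => freeX; exists (pt i), <<X>>%VS; split; last first.
  by rewrite (eqP freeX) size_map.
apply/seteqP; split=> x.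
  move=> [t [u [tA u1 ->]]]; exists (\sum_(v <- t) u v *: (v - pt i)); last first.
    under eq_bigr do rewrite scalerBr.
    by rewrite sumrB -scaler_suml u1 scale1r addrC subrK.
  rewrite /= big_seq; apply: memv_suml => v /tA [w [_ wA w1 ->]]; apply: memvZ.
  rewrite -[pt i]scale1r -w1 scaler_suml -sumrB; apply: memv_suml => j _.
  rewrite -scalerBr; have [|jA] := boolP (j \in [set j in i :: s]); last first.
    by rewrite wA // scale0r mem0v.
  rewrite !inE => /predU1P[->|js]; first by rewrite subrr scaler0 mem0v.
  by rewrite memvZ // memv_span //; apply/mapP; exists j.
pose Q u := exists w : J -> R,
  [/\ forall j, j \notin [set j in i :: s] -> w j = 0,
      \sum_j w j = 0 & u = \sum_j w j *: pt j].
have QZD k u v : Q u -> Q v -> Q (k *: u + v).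
  move=> [w [wA w0 ->]] [w' [wA' w0' ->]].
  exists (fun j => k * w j + w' j); split.
  - by move=> j jA; rewrite wA // wA' // mulr0 addr0.
  - by rewrite big_split /= -mulr_sumr w0 w0' mulr0 addr0.
  - rewrite scaler_sumr -big_split /=; apply: eq_bigr => j _.
    by rewrite scalerDl scalerA.
have Q0 : Q 0.
  exists (fun=> 0); split=> //; first by rewrite big1.
  by rewrite big1 // => j _; rewrite scale0r.
have sumdelta (V : lmodType R) (F : J -> V) j :
    \sum_k (k == j)%:R *: F k = F j.
  rewrite (bigD1 j) //= eqxx scale1r big1 ?addr0 // => k /negPf->.
  by rewrite scale0r.
have sum1 j : \sum_k ((k == j)%:R : R) = 1.
  by rewrite (bigD1 j) //= eqxx big1 ?addr0 // => k /negPf->.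
have QX v : v \in X -> Q v.
  move=> /mapP[j js ->]; exists (fun k => (k == j)%:R - (k == i)%:R); split.
  - move=> k; rewrite !inE negb_or => /andP[/negPf-> ks].
    by case: eqP ks js => [->|_ _ _]; [case: (_ \in _)|rewrite subr0].
  - by rewrite sumrB !sum1 subrr.
  - under eq_bigr do rewrite scalerBl.
    by rewrite sumrB !sumdelta.
move=> [u /= + <-]; rewrite -[X]in_tupleE => /coord_span ->.
have : Q (\sum_(k < size X) coord (in_tuple X) k u *: (in_tuple X)`_k).
  elim/big_rec: _ => // k v _ Qv; apply: QZD => //; apply: QX.
  exact: mem_nth.
move=> [w [wA w0 ->]]; rewrite -(sumdelta _ pt i) -big_split /=.
under eq_bigr do rewrite -scalerDl.
apply: affine_hull_point => [j jA|]; last by rewrite big_split /= w0 sum1 addr0.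
by rewrite wA // addr0; case: eqP => // ji; rewrite ji !inE eqxx in jA.
Qed.

Lemma has_dim_edge i j : i != j -> has_dim (hull [set k in [:: i; j]]) 1.
Proof.
move=> ij; apply: has_dim_simplex.
by rewrite seq1_free subr_eq0 (inj_eq point_inj) eq_sym.
Qed.

(** A facet through two of the points and not through the third shows that the
    three are not collinear. *)
Lemma has_dim_triangle h i j k :
  incident h j -> incident h k -> ~~ incident h i -> j != k ->
  has_dim (hull [set m in [:: i; j; k]]) 2.
Proof.
move=> hj hk hi jk; apply: has_dim_simplex.
have on m : incident h m -> dot (normal h) (pt m) = level h.
  by move=> hm; apply/eqP; have [_ ->] := incidentP h m.
have off : level h - dot (normal h) (pt i) != 0.
  by rewrite subr_eq0 eq_sym; have [_ ->] := incidentP h i.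
rewrite free_cons seq1_free span_seq1 subr_eq0 (inj_eq point_inj).
apply/andP; split; last by apply: contraNneq hi => <-.
apply/vlineP => -[t jE]; have := congr1 (dot (normal h)) jE.
rewrite dotZr !dotBr (on j hj) (on k hk) => tE.
have t1 : 1 = t by apply: (mulIf off); rewrite mul1r.
move: jE; rewrite -t1 scale1r => /addIr /point_inj jk'.
by rewrite jk' eqxx in jk.
Qed.

Lemma face_number0_le : (face_number body 0 <= #|J|)%N.
Proof.
apply: (@card_fset_set_le _ _ (fun j => [set pt j])) => F.
move=> [/face_exists[A FA] F0].
have [x Fx] := has_dim_neq0 F0.
have [j jA] : exists j, j \in A by apply: (@hull_neq0 _ x); rewrite -FA.
exists j => //; rewrite (has_dim0_set1 F0 (_ : F (pt j))) // FA.
exact: point_hull.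
Qed.

End Configuration.

(** * Facets of a polytope cut out by finitely many inequalities *)

Section Complete.
Variables (R : realType) (n : nat) (C : configuration R n).
Local Notation J := (vertex C).
Local Notation H := (facet C).
Local Notation pt := (@position R n C).
Hypothesis cut_out :
  forall x, (forall h : H, dot (normal h) x <= level h) -> body C x.

Lemma room x c :
  (forall h : H, dot (normal h) x < level h) ->
  exists2 e, 0 < e & body C (x + e *: c).
Proof.
move=> xlt.
(* exceeds the inverse of the longest step that any one inequality allows *)
pose S := 1 + \sum_(h : H) `|dot (normal h) c| / (level h - dot (normal h) x).
have pos (h : H) : 0 < level h - dot (normal h) x by rewrite subr_gt0.
have S1 : 1 <= S.
  by rewrite lerDl sumr_ge0 // => h _; rewrite divr_ge0 // ltW.
have S0 : 0 < S := lt_le_trans ltr01 S1.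
exists S^-1; first by rewrite invr_gt0.
apply: cut_out => h.
rewrite dotDr dotZr -lerBrDl mulrC ler_pdivrMr // mulrC -ler_pdivrMr //.
apply: le_trans (ler_norm _) _.
rewrite normrM [X in _ * X]gtr0_norm ?invr_gt0 //.
rewrite /S (bigD1 h) //= addrCA lerDl addr_ge0 // sumr_ge0 // => i _.
by rewrite divr_ge0 // ltW.
Qed.

(** The origin satisfies all the inequalities strictly, so some positive multiple
    [e *: x] of any [x] is in the body, and [x] is an affine combination of it
    and the origin. *)
Lemma affine_hull_body : affine_hull (body C) = [set: 'rV[R]_n].
Proof.
have O (h : H) : dot (normal h) 0 < level h by rewrite dot0r; exact: level_gt0.
apply/seteqP; split=> // x _.
have [e e0] := room x O; rewrite add0r => bx.
have b0 : body C 0 by apply: cut_out => h; exact: ltW.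
have [->|x0] := eqVneq x 0; first exact: sub_affine_hull.
exists [:: e *: x; 0], (fun v => if v == 0 then 1 - e^-1 else e^-1).
split.
- by move=> v; rewrite !inE => /orP[/eqP->|/eqP->].
- rewrite !big_cons big_nil scaler_eq0 gt_eqF //= (negPf x0) eqxx.
  by rewrite addr0 addrC subrK.
- rewrite !big_cons big_nil scaler_eq0 gt_eqF //= (negPf x0).
  by rewrite scaler0 !addr0 scalerA mulVf ?scale1r // gt_eqF.
Qed.

Lemma has_dim_body : has_dim (body C) n.
Proof.
exists 0, fullv; split; last by rewrite dimvf /dim /= mul1n.
rewrite affine_hull_body; apply/seteqP; split=> // x _.
by exists x; rewrite ?add0r //= memvf.
Qed.

(** Let [F] be a facet and [b] the barycentre of its vertices. If no inequality
    were an equality at [b], one could move from [b] in the direction of the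
    linear form defining [F] and stay in the body; so this form would be zero
    and [F] the whole body, of higher dimension. An inequality that is an
    equality at [b] is one on all of [F], and defines [F] as the direction
    space of [F] is a hyperplane. *)
Lemma face_number_facet_le k : n = k.+1 -> (face_number (body C) k <= #|H|)%N.
Proof.
move=> nk; apply: (@card_fset_set_le _ _
  (fun h : H => body C `&` [set x | dot (normal h) x = level h])) => F.
move=> [faceF dimF]; have [A FA] := face_exists faceF.
have [c [a [ca Fca]]] := faceF.
have [p [U [FU Uk]]] := dimF.
have Fp : affine_hull F p by rewrite FU; exists 0; rewrite ?addr0 //= mem0v.
have [x0 Fx0] := @has_dim_neq0 _ _ _ k dimF.
have [j0 j0A] : exists j, j \in A.
  by apply: (@hull_neq0 _ _ _ _ x0); rewrite -FA.
have A0 : (0 : R) < #|A|%:R by rewrite ltr0n; apply/card_gt0P; exists j0.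
pose b := \sum_(j in A) #|A|%:R^-1 *: pt j.
have bF : F b.
  rewrite FA; exists (fun j => if j \in A then #|A|%:R^-1 else 0); split.
  - by move=> j; case: ifP => // _; rewrite invr_ge0 ltW.
  - by move=> j /negPf->.
  - by rewrite -big_mkcond /= sumr_const -[LHS]mulr_natr mulVf // gt_eqF.
  - by rewrite /b big_mkcond; apply: eq_bigr => j _; case: ifP; rewrite ?scale0r.
have [h bh] : exists h : H, dot (normal h) b = level h.
  apply: contrapT => nobh.
  have blt (h : H) : dot (normal h) b < level h.
    rewrite lt_neqAle; apply/andP; split.
      by apply/eqP => bh; apply: nobh; exists h.
    apply: (@body_le _ _ C) => [j|]; first by have [] := incidentP h j.
    by rewrite Fca in bF; case: bF.
  have ba : dot c b = a by rewrite Fca in bF; case: bF.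
  have c0 : c = 0.
    apply/eqP; apply: contraT => /dot_gt0 c0.
    have [e e0 /ca] := room c blt.
    by rewrite dotDr dotZr ba gerDl leNgt mulr_gt0.
  have a0 : a = 0 by rewrite -ba c0 dot0l.
  have FT : F = body C.
    rewrite Fca c0 a0; apply/seteqP; split=> [x []//|x bx].
    by split=> //=; rewrite dot0l.
  have : U = fullv.
    apply/vspaceP => u; rewrite memvf.
    have : affine_hull F (p + u) by rewrite FT affine_hull_body.
    by rewrite FU => -[u' /= + /addrI <-].
  move=> UT; have := Uk; rewrite UT dimvf /dim /= mul1n nk => /eqP.
  by rewrite gtn_eqF.
have Ah j : j \in A -> dot (normal h) (pt j) = level h.
  move=> jA; have : \sum_(i in A) (level h - dot (normal h) (pt i)) = 0.
    rewrite sumrB sumr_const -bh /b -scaler_sumr dotZr dot_sumr.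
    by rewrite -[X in X - _]mulr_natl mulVKf ?subrr // gt_eqF.
  move/psumr_eq0P => /(_ _ _ jA) h0; apply/eqP.
  rewrite eq_sym -subr_eq0 h0 // => i _.
  by rewrite subr_ge0; have [] := incidentP h i.
have Fh x : F x -> dot (normal h) x = level h.
  rewrite FA => -[w [_ wA w1 ->]]; rewrite dot_combr -[RHS]mul1r -w1 mulr_suml.
  apply: eq_bigr => j _; have [/Ah->//|jA] := boolP (j \in A).
  by rewrite wA // !mul0r.
exists h => //; apply/seteqP; split=> x; last first.
  by move=> Fx; split; [rewrite Fca in Fx; case: Fx|exact: Fh].
move=> [bx /= xh]; rewrite Fca; split=> //=.
(* otherwise the direction from p to x would complete U to the whole space, and
   the form of h would vanish everywhere *)
have hF := dot_affine_hull Fh.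
have hU u : u \in U -> dot (normal h) u = 0.
  move=> uU; have : affine_hull F (p + u) by rewrite FU; exists u.
  by move=> /hF; rewrite dotDr (hF p) // -[RHS]addr0 => /addrI.
have ph : dot (normal h) (x - p) = 0 by rewrite dotBr xh hF // subrr.
have xU : x - p \in U.
  apply: contraT => xU; have : (U + <[x - p]>)%VS = fullv.
    apply/eqP; rewrite eqEdim subvf dimvf /dim /= mul1n [leqLHS]nk.
    rewrite dimv_disjoint_sum ?dim_vline ?Uk ?subr_eq0.
      by case: eqVneq => [xp|_]; rewrite ?addn1 //; rewrite xp subrr mem0v in xU.
    apply/eqP; rewrite -subv0; apply/subvP => u.
    rewrite memv_cap => /andP[uU /vlineP[t ut]]; rewrite memv0 ut scaler_eq0.
    have [//|t0] := eqVneq t 0.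
    by case/negP: xU; rewrite -[x - p](scalerK t0) -ut memvZ.
  move=> UT; have : pt j0 \in (U + <[x - p]>)%VS by rewrite UT memvf.
  move=> /memv_addP[u uU [_ /vlineP[t ->] j0E]].
  have := level_gt0 h; rewrite -(Ah j0 j0A) j0E dotDr dotZr ph hU // mulr0 addr0.
  by rewrite ltxx.
have : affine_hull F x by rewrite FU; exists (x - p) => //; rewrite addrC subrK.
by apply: dot_affine_hull => y; rewrite Fca => -[].
Qed.

End Complete.

(** * Convex combinations of prescribed total weight *)

Section Conic.
Variables (R : realType) (n : nat) (I : finType) (F : I -> 'rV[R]_n).

Definition conic (r : R) (x : 'rV[R]_n) :=
  exists w : I -> R,
    [/\ forall i, 0 <= w i, \sum_i w i = r & x = \sum_i w i *: F i].

Lemma conicD r s x y : conic r x -> conic s y -> conic (r + s) (x + y).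
Proof.
move=> [w [w0 <- ->]] [u [u0 <- ->]]; exists (fun i => w i + u i); split.
- by move=> i; rewrite addr_ge0.
- by rewrite big_split.
- by rewrite -big_split /=; apply: eq_bigr => i _; rewrite scalerDl.
Qed.

Lemma conicZ k r x : 0 <= k -> conic r x -> conic (k * r) (k *: x).
Proof.
move=> k0 [w [w0 <- ->]]; exists (fun i => k * w i); split.
- by move=> i; rewrite mulr_ge0.
- by rewrite mulr_sumr.
- by rewrite scaler_sumr; apply: eq_bigr => i _; rewrite scalerA.
Qed.

Lemma conic0 : conic 0 0.
Proof.
by exists (fun=> 0); split=> //; rewrite big1 // => i _; rewrite scale0r.
Qed.

Lemma conic1 i k : 0 <= k -> conic k (k *: F i).
Proof.
move=> k0; rewrite -[X in conic X]mulr1; apply: conicZ => //.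
exists (fun j => (j == i)%:R); split=> [j||]; first exact: ler0n.
  by rewrite (bigD1 i) //= eqxx big1 ?addr0 // => j /negPf->.
rewrite (bigD1 i) //= eqxx scale1r big1 ?addr0 // => j /negPf->.
by rewrite scale0r.
Qed.

End Conic.

(** The product weights [u i * v k / r] work; if [r = 0] all weights are zero,
    and so are these. *)
Lemma coupling (R : realType) (I K : finType) (u : I -> R) (v : K -> R) (r : R) :
    (forall i, 0 <= u i) -> (forall k, 0 <= v k) ->
    \sum_i u i = r -> \sum_k v k = r ->
  exists w : I * K -> R, [/\ forall p, 0 <= w p,
    forall i, \sum_k w (i, k) = u i & forall k, \sum_i w (i, k) = v k].
Proof.
move=> u0 v0 ur vr; have r0 : 0 <= r by rewrite -ur sumr_ge0.
exists (fun p => u p.1 * v p.2 / r); split=> [p|i|k] /=.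
- by rewrite divr_ge0 // mulr_ge0.
- rewrite -mulr_suml -mulr_sumr vr.
  have [r_eq0|r_neq0] := eqVneq r 0; last by rewrite mulfK.
  rewrite r_eq0 mulr0 mul0r; apply/esym/(@psumr_eq0P R I xpredT u) => //.
  by rewrite ur.
- rewrite -mulr_suml -mulr_suml ur.
  have [r_eq0|r_neq0] := eqVneq r 0; last by rewrite mulrAC mulfV ?mul1r.
  rewrite r_eq0 mul0r mul0r; apply/esym/(@psumr_eq0P R K xpredT v) => //.
  by rewrite vr.
Qed.

(** * Tents *)

(** An inner polygon, with vertices [base k] in cyclic order, inscribed in an
    outer one with vertices [apex k]. The form [edge k] is 1 on the inner edge
    from [base k] to [base (turn k)], and [apex k] lies above that edge, at
    twice its height. The form [side k] is 1 on the outer side that has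
    [base k] in its interior; it ends at [apex k] and at the apex before it. *)
Record tent (R : realType) := Tent {
  corner : finType;
  turn : corner -> corner;
  base : corner -> 'rV[R]_2;
  apex : corner -> 'rV[R]_2;
  edge : corner -> 'rV[R]_2;
  side : corner -> 'rV[R]_2;
  corner0 : corner;
  turn_inj : injective turn;
  turn_neq : forall k, turn k != k;
  turn2_neq : forall k, turn (turn k) != k;
  edge_base : forall k i,
    dot (edge k) (base i) <= 1 ?= iff (i == k) || (i == turn k);
  edge_apex : forall k i, dot (edge k) (apex i) <= 2 ?= iff (i == k);
  side_base : forall k i, dot (side k) (base i) <= 1 ?= iff (i == k);
  side_apex : forall k i,
    dot (side k) (apex i) <= 1 ?= iff (i == k) || (turn i == k)
}.

Section Tent.
Variables (R : realType) (T : tent R).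
Local Notation I := (corner T).
Local Notation s := (@turn R T).
Local Notation v := (@base R T).
Local Notation a := (@apex R T).
Local Notation e := (@edge R T).
Local Notation l := (@side R T).
Implicit Types (i j k : I) (x : 'rV[R]_2).

Lemma edge_start k : dot (e k) (v k) = 1.
Proof. by apply/eqP; have [_ ->] := edge_base k k; rewrite eqxx. Qed.

Lemma edge_end k : dot (e k) (v (s k)) = 1.
Proof. by apply/eqP; have [_ ->] := edge_base k (s k); rewrite eqxx orbT. Qed.

Lemma side_start k : dot (l k) (v k) = 1.
Proof. by apply/eqP; have [_ ->] := side_base k k; rewrite eqxx. Qed.

Lemma leif_lt (x y : R) (b : bool) : x <= y ?= iff b -> ~~ b -> x < y.
Proof. by move=> [xy <-] xny; rewrite lt_neqAle xny. Qed.

Lemma slack_ge0 (p t : R) : t < 1 -> p * t <= p -> 0 <= p.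
Proof.
by move=> t1; rewrite -subr_ge0 -{1}[p]mulr1 -mulrBr pmulr_lge0 // subr_gt0.
Qed.

(** Two distinct points of a line that misses the origin are independent. *)
Lemma base_span k x : exists p q, x = p *: v k + q *: v (s k).
Proof.
pose M : 'M[R]_2 := col_mx (v k) (v (s k)).
have rowM (u : 'rV[R]_2) : u *m M = lsubmx (u : 'rV_(1 + 1)) 0 0 *: v k
    + rsubmx (u : 'rV_(1 + 1)) 0 0 *: v (s k).
  have -> : u *m M = row_mx (lsubmx (u : 'rV_(1 + 1)))
      (rsubmx (u : 'rV_(1 + 1))) *m col_mx (v k) (v (s k)).
    by rewrite hsubmxK.
  rewrite mul_row_col [lsubmx _]mx11_scalar [rsubmx _]mx11_scalar.
  by rewrite !mul_scalar_mx !mxE /= !mulr1n.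
have : row_free M.
  apply: inj_row_free => u; rewrite rowM.
  set p := lsubmx _ 0 0; set q := rsubmx _ 0 0 => uM.
  have pq : p + q = 0.
    have := congr1 (dot (e k)) uM.
    by rewrite dotDr !dotZr edge_start edge_end dot0r !mulr1.
  have p0 : p = 0.
    have := congr1 (dot (l k)) uM; rewrite dotDr !dotZr dot0r.
    rewrite side_start.
    have := leif_lt (side_base k (s k)) (turn_neq k).
    have -> : q = - p by lra.
    move=> lt1 /eqP; rewrite mulr1 mulNr -{1}[p]mulr1 -mulrBr mulf_eq0.
    by case/orP=> [/eqP//|]; rewrite subr_eq0 eq_sym lt_eqF.
  have q0 : q = 0 by lra.
  rewrite -[u](@hsubmxK _ 1 1 1) [lsubmx _]mx11_scalar [rsubmx _]mx11_scalar.
  by rewrite -/p -/q p0 q0 !raddf0 row_mx0.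
by rewrite row_free_unit => Mu; rewrite -[x](mulmxKV Mu) rowM; do 2!eexists.
Qed.

(** The cone over an inner edge that contains [x] is found by maximizing
    [dot (edge k) x]: if [x] had a negative coefficient at one end of the edge,
    the form of the neighbouring edge at the other end would be larger. *)
Lemma fan x : exists k p q, [/\ 0 <= p, 0 <= q, x = p *: v k + q *: v (s k)
  & forall i, dot (e i) x <= p + q].
Proof.
case: (@arg_maxP _ _ _ (corner0 T) xpredT (fun i => dot (e i) x)) => //.
move=> k _ kmax.
have [p [q xE]] := base_span k x; exists k, p, q.
have ek : dot (e k) x = p + q.
  by rewrite xE dotDr !dotZr edge_start edge_end !mulr1.
split=> //; last by move=> i; rewrite -ek; exact: kmax.
- have /= := kmax (s k) isT; rewrite ek xE dotDr !dotZr edge_start.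
  have := @leif_lt _ _ _ (edge_base (s k) k) _.
  rewrite negb_or ![k == _]eq_sym turn_neq turn2_neq.
  by move=> /(_ isT) /slack_ge0 + xk; apply; move: xk; lra.
- pose j := finv s k; have sj : s j = k := f_finv (@turn_inj _ _) k.
  have ejk : dot (e j) (v k) = 1 by rewrite -{1}sj edge_end.
  have /= := kmax j isT; rewrite ek xE dotDr !dotZr ejk.
  have := @leif_lt _ _ _ (edge_base j (s k)) _; rewrite negb_or.
  rewrite -{1}sj turn2_neq (inj_eq (@turn_inj _ _)) -{1}sj turn_neq.
  by move=> /(_ isT) /slack_ge0 + xk; apply; move: xk; lra.
Qed.

(** The origin is in the inner polygon: the cones over the inner edges cover the
    plane, so one contains the opposite of the sum of the vertices, and this
    gives a positive combination equal to 0. *)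
Lemma conic_base0 r : 0 <= r -> conic v r 0.
Proof.
move=> r0; have [k [p [q [p0 q0 zE _]]]] := fan (- \sum_i v i).
pose N := \sum_(i : I) (1 : R) + (p + q).
have N0 : 0 < N.
  by rewrite ltr_wpDr ?addr_ge0 // sumr_const ltr0n; apply/card_gt0P; exists k.
have cN : conic v N 0.
  rewrite -[0 in X in conic _ _ X](subrr (\sum_i v i)) zE; apply: conicD.
    by exists (fun=> 1); split=> //; apply: eq_bigr => i _; rewrite scale1r.
  by apply: conicD; exact: conic1.
rewrite -[r](mulfVK (lt0r_neq0 N0)) -(scaler0 _ (r / N)); apply: conicZ => //.
by rewrite divr_ge0 // ltW.
Qed.

(** A point [x] of the outer polygon at height [t] above the origin is a
    combination of inner vertices and of an apex of total weights [t - 2 * h]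
    and [h], where [h] is the excess of [t] over 1. Above the inner edge [k],
    subtracting [h *: apex k] leaves nonnegative coefficients at the ends of
    the edge because [x] is on the inner side of the two outer sides through
    [apex k]. The weight of the inner part can be raised at will by adding a
    multiple of the origin. *)
Lemma tent_decomposition x :
  exists (k : I) (t : R), [/\ 0 <= t, dot (e k) x = t &
    (forall i, dot (l i) x <= 1) ->
    let h : R := Num.max 0 (t - 1) in
    forall r : R, t - 2 * h <= r ->
      exists y z : 'rV[R]_2, [/\ x = y + z, conic v r y & conic a h z]].
Proof.
have [k [p [q [p0 q0 xE _]]]] := fan x; exists k, (p + q).
split=> [||lx h r hr]; first exact: addr_ge0.
  by rewrite xE dotDr !dotZr edge_start edge_end !mulr1.
suff [y [z [-> cy cz]]] : exists y z,
    [/\ x = y + z, conic v (p + q - 2 * h) y & conic a h z].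
  exists y, z; split=> //.
  rewrite -[y]addr0 -[r](subrK (p + q - 2 * h)) addrC.
  by apply: conicD => //; apply: conic_base0; rewrite subr_ge0.
have [pq1|pq1] := leP (p + q) 1.
  have h0 : h = 0 by rewrite /h; apply/max_idPl; rewrite subr_le0.
  exists x, 0; rewrite addr0 h0 mulr0 subr0; split=> //; last exact: conic0.
  by rewrite xE; apply: conicD; exact: conic1.
have hE : h = p + q - 1 by rewrite /h; apply/max_idPr; rewrite subr_ge0 ltW.
have h0 : 0 < h by rewrite hE subr_gt0.
have [p' [q' aE]] := base_span k (a k).
have pq' : p' + q' = 2.
  have /eqP : dot (e k) (a k) == 2 by have [_ ->] := edge_apex k k.
  by rewrite aE dotDr !dotZr edge_start edge_end !mulr1.
have yE : x = ((p - h * p') *: v k + (q - h * q') *: v (s k)) + h *: a k.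
  by rewrite aE {1}xE !scalerBl scalerDr !scalerA addrACA !subrK.
have pk : 0 <= p - h * p'.
  have /eqP : dot (l (s k)) (a k) == 1.
    by have [_ ->] := side_apex (s k) k; rewrite eqxx orbT.
  have := @leif_lt _ _ _ (side_base (s k) k) _.
  rewrite eq_sym turn_neq => /(_ isT).
  have := lx (s k); rewrite aE xE !dotDr !dotZr side_start.
  by move=> lx1 /slack_ge0 + a1; apply; move: lx1 a1; rewrite hE; nra.
have qk : 0 <= q - h * q'.
  have /eqP : dot (l k) (a k) == 1.
    by have [_ ->] := side_apex k k; rewrite eqxx.
  have := @leif_lt _ _ _ (side_base k (s k)) _.
  rewrite turn_neq => /(_ isT).
  have := lx k; rewrite aE xE !dotDr !dotZr side_start.
  by move=> lx1 /slack_ge0 + a1; apply; move: lx1 a1; rewrite hE; nra.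
exists ((p - h * p') *: v k + (q - h * q') *: v (s k)), (h *: a k); split=> //.
  have -> : p + q - 2 * h = (p - h * p') + (q - h * q') by rewrite -pq'; ring.
  by apply: conicD; exact: conic1.
by apply: conic1; exact: ltW.
Qed.

End Tent.

(** * The product of two tents *)

Lemma sum_pair (V : nmodType) (I K : finType) (F : I * K -> V) :
  \sum_p F p = \sum_i \sum_k F (i, k).
Proof. by rewrite pair_bigA; apply: eq_bigr => -[]. Qed.

Section Product.
Variables (R : realType) (S T : tent R).
Local Notation I := (corner S).
Local Notation K := (corner T).
Local Notation cell := (I * K + (I + K))%type.
Implicit Types (h j : cell) (i : I) (k : K).

(** Vertices and facets have the same index set: the pairs of corners and the
    corners of either factor. The indices of facets stand for the ridges of the
    product of the inner polygons (edge times edge, or vertex times polygon),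
    and the facet is a bipyramid over that ridge. *)
Definition cell_position j : 'rV[R]_4 :=
  match j with
  | inl (i, k) => row_mx (base i) (base k)
  | inr (inl i) => row_mx (apex i) (0 : 'rV_2)
  | inr (inr k) => row_mx (0 : 'rV_2) (apex k)
  end.

Definition cell_normal h : 'rV[R]_4 :=
  match h with
  | inl (i, k) => row_mx (edge i) (edge k)
  | inr (inl i) => row_mx (side i) (0 : 'rV_2)
  | inr (inr k) => row_mx (0 : 'rV_2) (side k)
  end.

Definition cell_level h : R := if h is inl _ then 2 else 1.

Definition cell_incident h j : bool :=
  match h, j with
  | inl (i, k), inl (i', k') =>
      ((i' == i) || (i' == turn i)) && ((k' == k) || (k' == turn k))
  | inl (i, _), inr (inl i') => i' == i
  | inl (_, k), inr (inr k') => k' == k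
  | inr (inl i), inl (i', _) => i' == i
  | inr (inr k), inl (_, k') => k' == k
  | inr (inl i), inr (inl i') => (i' == i) || (turn i' == i)
  | inr (inr k), inr (inr k') => (k' == k) || (turn k' == k)
  | _, _ => false
  end.

Lemma dot22 (c d x y : 'rV[R]_2) :
  dot (row_mx c d : 'rV[R]_4) (row_mx x y : 'rV[R]_4) = dot c x + dot d y.
Proof. exact: (@dot_row R 2 2). Qed.

Lemma cell_level_gt0 h : 0 < cell_level h.
Proof. by case: h => *; rewrite /= ?ltr01 ?ltr0Sn. Qed.

Lemma cell_incidentP h j :
  dot (cell_normal h) (cell_position j) <= cell_level h ?= iff cell_incident h j.
Proof.
have no (x : R) : 0 < x -> 0 <= x ?= iff false.
  by move=> x0; split; [exact: ltW|rewrite lt_eqF].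
case: h j => [[i k]|[i|k]] [[i' k']|[i'|k']] /=;
  rewrite dot22 ?dot0r ?dot0l ?addr0 ?add0r.
- by rewrite -[2]/(1 + 1); apply: leifD; exact: edge_base.
- exact: edge_apex.
- exact: edge_apex.
- exact: side_base.
- exact: side_apex.
- exact: no.
- exact: side_base.
- exact: no.
- exact: side_apex.
Qed.

Lemma cell_incident_inj (x y : cell) :
  (forall h, cell_incident h x = cell_incident h y) -> x = y.
Proof.
case: x y => [[i k]|[i|k]] [[i' k']|[i'|k']] E.
- have := E (inr (inl i)); have := E (inr (inr k)).
  by rewrite /= !eqxx => /esym/eqP-> /esym/eqP->.
- by have := E (inr (inr k)); rewrite /= eqxx.
- by have := E (inr (inl i)); rewrite /= eqxx.
- by have := E (inr (inr k')); rewrite /= eqxx.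
- by have := E (inl (i, corner0 T)); rewrite /= eqxx => /esym/eqP->.
- by have := E (inr (inl i)); rewrite /= eqxx.
- by have := E (inr (inl i')); rewrite /= eqxx.
- by have := E (inr (inr k)); rewrite /= eqxx.
- by have := E (inl (corner0 S, k)); rewrite /= eqxx => /esym/eqP->.
Qed.

Definition tent_product : configuration R 4 :=
  Configuration cell_level_gt0 cell_incidentP cell_incident_inj.

Local Notation C := tent_product.

(** Let [t] and [u] be the heights of the two components, with [t + u <= 2], and
    [p], [q] their excesses over 1, of which at most one is positive. The inner
    parts of both components can then be given the same total weight
    [1 - p - q], and a coupling of their weights is a weight on the pairs. *)
Lemma tent_product_cut_out x :
  (forall h : facet C, dot (normal h) x <= level h) -> body C x.
Proof.
pose x1 : 'rV[R]_2 := lsubmx (x : 'rV_(2 + 2)).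
pose x2 : 'rV[R]_2 := rsubmx (x : 'rV_(2 + 2)).
have xE : x = row_mx x1 x2 :> 'rV_(2 + 2) by rewrite hsubmxK.
have dotx (c1 c2 : 'rV[R]_2) :
    dot (row_mx c1 c2 : 'rV_4) x = dot c1 x1 + dot c2 x2.
  by rewrite -dot_row -xE.
move=> hx.
have [i [t [t0 it decx1]]] := tent_decomposition S x1.
have [k [u [u0 ku decx2]]] := tent_decomposition T x2.
have tu : t + u <= 2.
  by rewrite -it -ku -dotx; exact: (hx (inl (i, k))).
have side1 (m : I) : dot (side m) x1 <= 1.
  by have := hx (inr (inl m)); rewrite /= dotx dot0l addr0.
have side2 (m : K) : dot (side m) x2 <= 1.
  by have := hx (inr (inr m)); rewrite /= dotx dot0l add0r.
have {decx1} := decx1 side1; have {decx2} := decx2 side2 => /=.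
set p := Num.max 0 (t - 1); set q := Num.max 0 (u - 1) => decx2 decx1.
have [] : t - 2 * p <= 1 - p - q /\ u - 2 * q <= 1 - p - q.
  rewrite /p /q; have [t1|t1] := leP 0 (t - 1);
    by have [u1|u1] := leP 0 (u - 1); split; lra.
move=> /decx1 [y1 [z1 [x1E [w1 [w1_ge0 w1r y1E]] [a [a0 ap z1E]]]]].
move=> /decx2 [y2 [z2 [x2E [w2 [w2_ge0 w2r y2E]] [b [b0 bq z2E]]]]].
have [w [w0 wI wK]] := coupling w1_ge0 w2_ge0 w1r w2r.
pose W (j : cell) :=
  match j with inl c => w c | inr (inl i) => a i | inr (inr k) => b k end.
rewrite bodyE; exists W; split.
- by case=> [c|[m|m]] /=.
- by move=> j; rewrite inE.
- by rewrite !big_sumType /= ap bq sum_pair (eq_bigr w1) // w1r; lra.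
- suff [El Er] : x1 = lsubmx (\sum_j W j *: cell_position j : 'rV_(2 + 2)) /\
      x2 = rsubmx (\sum_j W j *: cell_position j : 'rV_(2 + 2)).
    by rewrite xE El Er hsubmxK.
  have scaleL (z : R) (y : 'rV[R]_(2 + 2)) : lsubmx (z *: y) = z *: lsubmx y.
    exact: linearZ.
  have scaleR (z : R) (y : 'rV[R]_(2 + 2)) : rsubmx (z *: y) = z *: rsubmx y.
    exact: linearZ.
  rewrite !linear_sum !big_sumType /=; split.
  - rewrite sum_pair /= x1E y1E z1E; congr (_ + _).
      apply: eq_bigr => m _; under [RHS]eq_bigr do rewrite scaleL row_mxKl.
      by rewrite -scaler_suml wI.
    rewrite [X in _ = _ + X]big1 ?addr0 => [|m _].
      by apply: eq_bigr => m _; rewrite scaleL row_mxKl.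
    by rewrite scaleL row_mxKl scaler0.
  - rewrite sum_pair /= x2E y2E z2E exchange_big; congr (_ + _).
      apply: eq_bigr => m _; under [RHS]eq_bigr do rewrite scaleR row_mxKr.
      by rewrite -scaler_suml wK.
    rewrite [X in _ = X + _]big1 ?add0r => [|m _].
      by apply: eq_bigr => m _; rewrite scaleR row_mxKr.
    by rewrite scaleR row_mxKr scaler0.
Qed.

Lemma leq_face_number03 :
  (face_number (body C) 0 + face_number (body C) 3 <=
   2 * (#|I| * #|K| + (#|I| + #|K|)))%N.
Proof.
have cardC : #|{: cell}| = (#|I| * #|K| + (#|I| + #|K|))%N.
  by rewrite !card_sum card_prod.
rewrite mul2n -addnn -{1}cardC -cardC; apply: leq_add.
  exact: face_number0_le.
by apply: face_number_facet_le => //; exact: tent_product_cut_out.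
Qed.

(** * Edges and triangles of the product *)

Lemma cell_eqE :
  (((forall i k i' k',
      (inl (i, k) == inl (i', k') :> cell) = (i == i') && (k == k'))
  * (forall i i', (inr (inl i) == inr (inl i') :> cell) = (i == i'))
  * (forall k k', (inr (inr k) == inr (inr k') :> cell) = (k == k')))
  * ((forall c d, (inl c == inr d :> cell) = false)
  * (forall c d, (inr c == inl d :> cell) = false)
  * (forall i k, (inr (inl i) == inr (inr k) :> cell) = false)
  * (forall i k, (inr (inr k) == inr (inl i) :> cell) = false)))%type.
Proof. by []. Qed.

Lemma turnE (U : tent R) (i : corner U) :
  [/\ turn i <> i, i <> turn i, turn (turn i) <> i & i <> turn (turn i)].
Proof.
split; apply/eqP; rewrite ?turn_neq ?turn2_neq // eq_sym.
  exact: turn_neq.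
exact: turn2_neq.
Qed.

(** Membership of cells in explicit lists is a boolean combination of equalities
    between corners; with all their truth values fixed, what remains follows by
    congruence from the facts in [turnE]. *)
Ltac split_cells :=
  rewrite /= ?inE ?eqxx ?orbT ?cell_eqE ?(inj_eq (@turn_inj _ _)) /=.
Ltac decide_cells :=
  repeat match goal with
  | |- context [?x == ?y] => case: (@eqP _ x y) => ? //=
  end; try congruence.

(** The edges are those of the product of the inner polygons and those from an
    apex to the vertices of the facet below it. In the factor other than that
    of its direction, or of its apex, an edge is placed at [turn k], so that
    both facets next to it there, at [k] and at [turn k], can be named. *)
Local Notation edge_index :=
  (bool * (I * K) + bool * (bool * (I * K)))%type.

Definition edge_vertices (c : edge_index) : seq cell :=
  match c with
  | inl (false, (i, k)) => [:: inl (i, turn k); inl (turn i, turn k)]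
  | inl (true, (i, k)) => [:: inl (turn i, k); inl (turn i, turn k)]
  | inr (false, (b, (i, k))) =>
      [:: inr (inl i); inl (if b then turn i else i, turn k)]
  | inr (true, (b, (i, k))) =>
      [:: inr (inr k); inl (turn i, if b then turn k else k)]
  end.

Definition edge_facets (c : edge_index) : seq cell :=
  match c with
  | inl (false, (i, k)) => [:: inl (i, k); inl (i, turn k); inr (inr (turn k))]
  | inl (true, (i, k)) => [:: inl (i, k); inl (turn i, k); inr (inl (turn i))]
  | inr (false, (b, (i, k))) =>
      [:: inl (i, k); inl (i, turn k); inr (inl (if b then turn i else i))]
  | inr (true, (b, (i, k))) =>
      [:: inl (i, k); inl (turn i, k); inr (inr (if b then turn k else k))]
  end.

Lemma edge_meet c :
  [set j in edge_vertices c] = meet (edge_facets c : seq (facet C)).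
Proof.
apply/setP => j; rewrite [LHS]inE [RHS]inE.
case: c => [[[] [i k]]|[[] [[] [i k]]]]; case: j => [[i' k']|[i'|k']].
all: split_cells.
all: have [? ? ? ?] := turnE i; have [? ? ? ?] := turnE k.
all: decide_cells.
Qed.

Lemma edge_inj : injective (fun c => [set j in edge_vertices c]).
Proof.
move=> c d /setP E.
have {}E : forall j, (j \in edge_vertices c) = (j \in edge_vertices d).
  by move=> j; have := E j; rewrite !inE.
case: c d E => [[[] [i k]]|[[] [[] [i k]]]]
  [[[] [i' k']]|[[] [[] [i' k']]]] /= E.
all: have [? ? ? ?] := turnE i; have [? ? ? ?] := turnE k.
all: have [? ? ? ?] := turnE i'; have [? ? ? ?] := turnE k'.
(* both ends of the first edge are ends of the second *)
all: match type of E with forall j, (j \in [:: ?x; ?y]) = _ =>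
  have := E x; have := E y end; split_cells.
all: try by [].
all: decide_cells.
Qed.

Lemma leq_face_number1 : (6 * (#|I| * #|K|) <= face_number (body C) 1)%N.
Proof.
have cardE : #|{: edge_index}| = (6 * (#|I| * #|K|))%N.
  by rewrite card_sum !card_prod card_bool; ring.
rewrite -cardE.
apply: (@card_face_ge _ _ C _ (fun c => [set j in edge_vertices c])).
- exact: edge_inj.
- by move=> c; exists (edge_facets c); exact: edge_meet.
- case=> [[[] [i k]]|[[] [[] [i k]]]] /=; apply: has_dim_edge.
  all: rewrite ?cell_eqE ?(inj_eq (@turn_inj _ _)) //=.
  all: by rewrite negb_and eq_sym turn_neq ?orbT.
Qed.

(** Each triangle joins an edge of the product of the inner polygons to the apex
    over one of the three facets of the product that contain it: one in the
    factor along which the edge runs ([None]), two in the other factor. *)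
Local Notation triangle_index := (bool * option bool * (I * K))%type.

Definition triangle_vertices (c : triangle_index) : seq cell :=
  match c with
  | (false, o, (i, k)) =>
      [:: inr (if o is Some b then inr (if b then turn k else k) else inl i);
          inl (i, turn k); inl (turn i, turn k)]
  | (true, o, (i, k)) =>
      [:: inr (if o is Some b then inl (if b then turn i else i) else inr k);
          inl (turn i, k); inl (turn i, turn k)]
  end.

Definition triangle_facets (c : triangle_index) : seq cell :=
  match c with
  | (false, None, (i, k)) => [:: inl (i, k); inl (i, turn k)]
  | (false, Some b, (i, k)) =>
      [:: inl (i, if b then turn k else k); inr (inr (turn k))]
  | (true, None, (i, k)) => [:: inl (i, k); inl (turn i, k)]
  | (true, Some b, (i, k)) =>
      [:: inl (if b then turn i else i, k); inr (inl (turn i))]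
  end.

Lemma triangle_meet c :
  [set j in triangle_vertices c] = meet (triangle_facets c : seq (facet C)).
Proof.
apply/setP => j; rewrite [LHS]inE [RHS]inE.
case: c => [[[] [[]|]] [i k]]; case: j => [[i' k']|[i'|k']].
all: split_cells.
all: have [? ? ? ?] := turnE i; have [? ? ? ?] := turnE k.
all: decide_cells.
Qed.

Lemma triangle_inj : injective (fun c => [set j in triangle_vertices c]).
Proof.
move=> c d /setP E.
have {}E : forall j, (j \in triangle_vertices c) = (j \in triangle_vertices d).
  by move=> j; have := E j; rewrite !inE.
case: c d E => [[[] [[]|]] [i k]] [[[] [[]|]] [i' k']] /= E.
all: have [? ? ? ?] := turnE i; have [? ? ? ?] := turnE k.
all: have [? ? ? ?] := turnE i'; have [? ? ? ?] := turnE k'.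
all: match type of E with forall j, (j \in [:: ?x; ?y; ?z]) = _ =>
  have := E x; have := E y; have := E z end; split_cells.
all: try by [].
all: decide_cells.
Qed.

Lemma leq_face_number2 : (6 * (#|I| * #|K|) <= face_number (body C) 2)%N.
Proof.
have cardE : #|{: triangle_index}| = (6 * (#|I| * #|K|))%N.
  by rewrite !card_prod card_option card_bool.
rewrite -cardE.
apply: (@card_face_ge _ _ C _ (fun c => [set j in triangle_vertices c])).
- exact: triangle_inj.
- by move=> c; exists (triangle_facets c); exact: triangle_meet.
(* in each case, the facet named contains the edge but not the apex *)
- case=> [[[] o] [i k]] /=.
  + apply: (@has_dim_triangle _ _ C
        (if o is Some b then inl (if b then i else turn i, k)
         else inr (inl (turn i))));
      have [? ? ? ?] := turnE i; have [? ? ? ?] := turnE k;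
      case: o => [[]|]; split_cells; decide_cells.
  + apply: (@has_dim_triangle _ _ C
        (if o is Some b then inl (i, if b then k else turn k)
         else inr (inr (turn k))));
      have [? ? ? ?] := turnE i; have [? ? ? ?] := turnE k;
      case: o => [[]|]; split_cells; decide_cells.
Qed.

Lemma face_number0_gt0 : (0 < face_number (body C) 0)%N.
Proof.
rewrite -[leqLHS]card_unit; pose i := corner0 S.
apply: (@card_face_ge _ _ C _ (fun=> [set j in [:: inr (inl i) : cell]])).
- by move=> [] [].
- move=> _; exists [:: inr (inl i); inr (inl (turn i))]; apply/setP => j.
  rewrite [LHS]inE [RHS]inE.
  case: j => [[i' k']|[i'|k']].
  all: split_cells.
  all: have [? ? ? ?] := turnE i.
  all: decide_cells.
- move=> _; apply: (@has_dim_simplex _ _ C (inr (inl i)) [::]); exact: nil_free.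
Qed.

End Product.

(** * A tent with eleven corners *)

(* the key Z is that of the scope of the type int *)
Delimit Scope Z_scope with BZ.

Section Eleven.
Variable R : realType.

Definition ZtoR (z : Z) : R := (int_of_Z z)%:~R.

Lemma ZtoRD x y : ZtoR (x + y)%BZ = ZtoR x + ZtoR y.
Proof. by rewrite -intrD; congr intmul; lia. Qed.

Lemma ZtoRM x y : ZtoR (x * y)%BZ = ZtoR x * ZtoR y.
Proof. by rewrite -intrM; congr intmul; lia. Qed.

Lemma leif_ZtoR (x y : Z) b :
  (x <=? y)%BZ -> (x =? y)%BZ = b -> ZtoR x <= ZtoR y ?= iff b.
Proof.
move=> xy <-; split; first by rewrite ler_int; lia.
by rewrite eqr_int; apply/idP/idP; lia.
Qed.

Lemma ZtoR_gt0 x : (0 <? x)%BZ -> 0 < ZtoR x.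
Proof. by rewrite ltr0z; lia. Qed.

Definition vec (p : Z * Z) : 'rV[R]_2 :=
  \row_j ZtoR (if j == 0 then p.1 else p.2).

Definition zdot (p q : Z * Z) : Z := (p.1 * q.1 + p.2 * q.2)%BZ.

Definition znormal (p q : Z * Z) : Z * Z := (q.2 - p.2, p.1 - q.1)%BZ.
Definition zdet (p q : Z * Z) : Z := (p.1 * q.2 - p.2 * q.1)%BZ.

(** The linear form that is 1 on the line through [p] and [q]. *)
Definition line p q : 'rV[R]_2 := (ZtoR (zdet p q))^-1 *: vec (znormal p q).

Definition line_check c b p q x : bool :=
  [&& (0 <? zdet p q)%BZ, (zdot (znormal p q) x <=? c * zdet p q)%BZ
    & (zdot (znormal p q) x =? c * zdet p q)%BZ == b].

Lemma dot_vec p q : dot (vec p) (vec q) = ZtoR (zdot p q).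
Proof.
by rewrite /dot !big_ord_recl big_ord0 !mxE /= addr0 -!ZtoRM -ZtoRD.
Qed.

Lemma line_checkP c b p q x : line_check c b p q x ->
  dot (line p q) (vec x) <= ZtoR c ?= iff b.
Proof.
move=> /and3P[/ZtoR_gt0 d0 le1 /eqP eq1]; have := leif_ZtoR le1 eq1.
rewrite dotC dotZr dotC dot_vec ZtoRM => -[le2 eq2]; split.
  by rewrite mulrC ler_pdivrMr.
by rewrite -eq2 mulrC -[RHS](inj_eq (divIf (lt0r_neq0 d0))) mulfK ?lt0r_neq0.
Qed.

(** The two polygons are symmetric in the first axis. An apex twice as far as the
    edge below it, seen under a small angle, forces neighbouring inner vertices
    to be at very different distances from the origin. So the origin lies close
    to one end of the polygons, and on the way there the vertices approach it
    almost geometrically, as on a parabola scaled by (x, y) -> (s^2 x, s y). *)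
Definition bases : seq (Z * Z) :=
  [:: (14616, -1872); (14616, 1872); (2436, 624); (406, 164); (71, 34); (1, 2);
      (-1, 0); (1, -2); (71, -34); (406, -164); (2436, -624)]%BZ.

Definition apices : seq (Z * Z) :=
  [:: (29232, 0); (12992, 2080); (1624, 512); (343, 146); (37, 20); (-1, 1);
      (-1, -1); (37, -20); (343, -146); (1624, -512); (12992, -2080)]%BZ.

Definition zbase k := nth (0, 0)%BZ bases k.
Definition zapex k := nth (0, 0)%BZ apices k.
Definition succ11 k := (k.+1 %% 11)%N.

Definition tent_check (k i : nat) : bool :=
  let v := zbase k in let w := zbase (succ11 k) in
  [&& line_check 1 ((i == k) || (i == succ11 k)) v w (zbase i),
      line_check 2 (i == k) v w (zapex i),
      line_check 1 (i == k) v (zapex k) (zbase i)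
    & line_check 1 ((i == k) || (succ11 i == k)) v (zapex k) (zapex i)].

Lemma tent_checkP (k i : 'I_11) : tent_check k i.
Proof.
have : all (fun k => all (tent_check k) (iota 0 11)) (iota 0 11) by vm_compute.
move/allP/(_ k); rewrite mem_iota ltn_ord => /(_ isT)/allP/(_ i).
by rewrite mem_iota ltn_ord => /(_ isT).
Qed.

Definition eleven_tent : tent R.
Proof.
refine (@Tent R 'I_11 (@ordS 11)
  (fun k => vec (zbase k)) (fun k => vec (zapex k))
  (fun k => line (zbase k) (zbase (succ11 k)))
  (fun k => line (zbase k) (zapex k)) ord0 _ _ _ _ _ _ _).
- exact: ordS_inj.
- by move=> k; rewrite -val_eqE /=; have := ltn_ord k; lia.
- by move=> k; rewrite -val_eqE /=; have := ltn_ord k; lia.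
- by move=> k i; have /and4P[+ _ _ _] := tent_checkP k i; exact: line_checkP.
- by move=> k i; have /and4P[_ + _ _] := tent_checkP k i; exact: line_checkP.
- by move=> k i; have /and4P[_ _ + _] := tent_checkP k i; exact: line_checkP.
- by move=> k i; have /and4P[_ _ _] := tent_checkP k i; exact: line_checkP.
Defined.

End Eleven.

(** For m = n = 11 the bounds are f1 + f2 >= 12 * 121 = 1452 and
    f0 + f3 <= 2 * 143 = 286. *)
Theorem theorem1 (R : realType) :
  exists P : set 'rV[R]_4,
    [/\ is_polytope P, has_dim P 4 & 5.048%Q < fatness P].
Proof.
pose T := eleven_tent R; pose C := tent_product T T.
exists (body C); split.
- by exists (codom (@position R 4 C)).
- exact: has_dim_body (@tent_product_cut_out R T T).
have cardT : #|corner T| = 11 by exact: card_ord.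
have := leq_face_number03 T T; have := leq_face_number1 T T.
have := leq_face_number2 T T; have := face_number0_gt0 T T.
rewrite -/C cardT /fatness.
set f0 := face_number _ 0; set f1 := face_number _ 1.
set f2 := face_number _ 2; set f3 := face_number _ 3 => f0_gt0 f2_ge f1_ge f03.
have den_gt0 : 0 < (f0 + f3)%:R :> rat by rewrite ltr0n addn_gt0 f0_gt0.
rewrite ltr_pdivlMr //.
have num : 1452%:R <= (f1 + f2)%:R :> rat.
  by rewrite ler_nat (leq_add f1_ge f2_ge).
have den : (f0 + f3)%:R <= 286%:R :> rat by rewrite ler_nat.
have -> : 5.048%Q = 631 / 125 :> rat by [].
lra.
Qed.
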